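(* For every integer $n\ge 1$, let $M(n)=M(n)(X,q)$ be the $n\times n$ tridiagonal matrix with entries ($1\le i,j\le n$) $$ M(n)_{i,j}=\begin{cases} 1 & \text{if } i-j=0,\\ \sqrt{X}\,q^{(i-1)/2} & \text{if } i-j=-1,\\ \sqrt{X}\,q^{(i-2)/2} & \text{if } i-j=1,\\ 0 & \text{otherwise.}\end{cases} $$ Then $$ \det M(n)(X,q)=\sum_{a=0}^{\lfloor n/2\rfloor}\frac{(-1)^a X^a q^{a(a-1)}\,(1-q^{n-a})(1-q^{n-a-1})\cdots(1-q^{n-2a+1})}{(1-q)(1-q^2)\cdots(1-q^a)}. $$
   Context: $X$ and $q$ are indeterminates; $\sqrt{X}$ and $q^{1/2}$ denote fixed square roots of $X$ and $q$, and $q^{k/2}=(q^{1/2})^k$ for integers $k$. In the $a$-th summand, the product in the numerator $(1-q^{n-a})(1-q^{n-a-1})\cdots(1-q^{n-2a+1})$ has exactly $a$ factors $1-q^{m}$, with $m$ running from $n-2a+1$ to $n-a$; the product in the denominator is $\prod_{k=1}^{a}(1-q^k)$. For $a=0$ both products are empty and equal $1$, so the $a=0$ summand is $1$. *)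

(* Defs.v *)
From HB Require Import structures.
From mathcomp Require Import all_boot all_order all_algebra.

Set Implicit Arguments.
Unset Strict Implicit.
Unset Printing Implicit Defensive.

Import GRing.Theory.
Local Open Scope ring_scope.

(* The field R(X, q) of rational functions over an integral domain R, built
   as Frac(R[q][X]): the outer polynomial variable is X, the inner one is q. *)
Definition ratfun (R : idomainType) : fieldType := {fraction {poly {poly R}}}.

Definition indetX (R : idomainType) : ratfun R := tofrac ('X : {poly {poly R}}).

Definition indetq (R : idomainType) : ratfun R := tofrac ('X%:P : {poly {poly R}}).

Section TridiagonalMatrix.

(* [sX] and [sq] stand for the square roots of X and q. *)
Variables (K : fieldType) (sX sq : K).

(* Here i and j are the 1-based indices, and [sq ^ k], with k : int, is
   q ^ (k / 2). *)
Definition M_entry (i j : int) : K :=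
  if i - j == 0 then 1
  else if i - j == -1 then sX * sq ^ (i - 1)
  else if i - j == 1 then sX * sq ^ (i - 2)
  else 0.

Definition M (n : nat) : 'M[K]_n :=
  \matrix_(i < n, j < n) M_entry i.+1%:Z j.+1%:Z.

End TridiagonalMatrix.

(* Main.v *)
Require Import Defs.
From mathcomp Require Import all_boot all_order all_algebra.
From mathcomp Require Import zify ring.

(* Expanding along the last row and column, the determinants satisfy
   D(n+2) = D(n+1) - X q^n D(n).  The a-th summand is
   (-1)^a X^a q^(a(a-1)) times the Gaussian binomial [n-a, a], and the q-Pascal
   rule [m+1, a+1] = [m, a+1] + q^(m-a) [m, a] gives the sum the same
   recurrence. *)

Set Implicit Arguments.
Unset Strict Implicit.
Unset Printing Implicit Defensive.

Import GRing.Theory.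
Local Open Scope ring_scope.

Lemma det_tridiagonal_rec (R : comNzRingType) (f : nat -> nat -> R) (n : nat) :
  (forall i j, (i.+1 < j)%N || (j.+1 < i)%N -> f i j = 0) ->
  \det (\matrix_(i < n.+2, j < n.+2) f i j) =
  f n.+1 n.+1 * \det (\matrix_(i < n.+1, j < n.+1) f i j)
  - f n n.+1 * f n.+1 n * \det (\matrix_(i < n, j < n) f i j).
Proof.
move=> f0.
(* Only the last two entries of the last row can be nonzero. *)
rewrite (expand_det_row _ ord_max) big_ord_recr big_ord_recr /=.
rewrite big1 ?add0r => [|j _]; last first.
  by rewrite mxE f0 ?mul0r //=; apply/orP; right; rewrite !ltnS.
rewrite !mxE /= addrC /cofactor /=.
have -> : (-1 : R) ^+ (n.+1 + n.+1) = 1 by rewrite -signr_odd addnn odd_double.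
have -> : (-1 : R) ^+ (n.+1 + n) = -1.
  by rewrite -signr_odd addSn addnn /= odd_double.
rewrite mul1r mulN1r mulrN; congr (_ * \det _ - _).
  apply/matrixP => i j; rewrite !mxE /= /bump.
  by have := ltn_ord i; have := ltn_ord j => ? ?; congr f; lia.
rewrite -mulrA mulrCA; congr (_ * _).
(* This minor lacks the last row and column [n]. Its last column is the old column [n.+1], where
   only [f n n.+1] survives. *)
rewrite (expand_det_col _ ord_max) big_ord_recr /=.
rewrite big1 ?add0r => [|i _]; last first.
  rewrite !mxE /= /bump leqnn /= f0 ?mul0r //; apply/orP; left.
  by have := ltn_ord i; lia.
rewrite !mxE /= /bump leqnn ltnn /= /cofactor /=.
rewrite -signr_odd addnn odd_double mul1r; congr (_ * \det _).
apply/matrixP => i j; rewrite !mxE /= /bump.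
by have := ltn_ord i; have := ltn_ord j => ? ?; congr f; lia.
Qed.

Section QFalling.

Variables (K : fieldType) (q : K).

(* For [m < a] the factor [i = m] is zero, so truncated subtraction is harmless. *)
Definition qfalling (m a : nat) : K := \prod_(i < a) (1 - q ^+ (m - i)).

Lemma qfalling0 m : qfalling m 0 = 1.
Proof. exact: big_ord0. Qed.

Lemma qfalling_small m a : (m < a)%N -> qfalling m a = 0.
Proof.
move=> lt_ma; apply/eqP/prodf_eq0; exists (Ordinal lt_ma) => //=.
by rewrite subnn expr0 subrr.
Qed.

Lemma qfallingSr m a : qfalling m a.+1 = qfalling m a * (1 - q ^+ (m - a)).
Proof. exact: big_ord_recr. Qed.

Lemma qfallingSS m a : qfalling m.+1 a.+1 = (1 - q ^+ m.+1) * qfalling m a.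
Proof. by rewrite /qfalling big_ord_recl. Qed.

Lemma prod_nat_qfalling m a : (a <= m)%N ->
  \prod_(m - a + 1 <= k < m.+1) (1 - q ^+ k) = qfalling m a.
Proof.
elim: a => [|a IHa] lt_am; first by rewrite subn0 addn1 big_geq ?qfalling0.
have -> : (m - a.+1 + 1 = m - a)%N by lia.
rewrite big_ltn; last by lia.
by rewrite -(addn1 (m - a)) IHa ?(ltnW lt_am) // mulrC qfallingSr.
Qed.

(** No positive power of [q] is 1, so the denominators $(1-q)\cdots(1-q^a)$ are invertible. *)
Hypothesis q_free : forall k, 1 - q ^+ k.+1 != 0.

Lemma qfalling_neq0 a : qfalling a a != 0.
Proof. by elim: a => [|a IHa]; rewrite ?qfalling0 ?oner_eq0 // qfallingSS mulf_neq0. Qed.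

Definition qbinom (m a : nat) : K := qfalling m a / qfalling a a.

Lemma qbinom0 m : qbinom m 0 = 1.
Proof. by rewrite /qbinom !qfalling0 divr1. Qed.

Lemma qbinom_small m a : (m < a)%N -> qbinom m a = 0.
Proof. by move=> lt_ma; rewrite /qbinom qfalling_small // mul0r. Qed.

(** Over a common denominator this is $1-q^{m+1} = (1-q^{m-a}) + q^{m-a}(1-q^{a+1})$. For $m<a$ all
    three binomials vanish. *)
Lemma qbinomS m a :
  qbinom m.+1 a.+1 = qbinom m a.+1 + q ^+ (m - a) * qbinom m a.
Proof.
have [le_am|lt_ma] := leqP a m; last first.
  by rewrite !qbinom_small ?mulr0 ?addr0 // ltnW.
rewrite /qbinom !qfallingSS qfallingSr.
have -> : q ^+ m.+1 = q ^+ (m - a) * q ^+ a.+1 by rewrite -exprD; congr (_ ^+ _); lia.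
have := q_free a; have := qfalling_neq0 a.
move: (q ^+ a.+1) => u nz_f nz_u.
by field; rewrite nz_u nz_f.
Qed.

Variable X : K.

Definition det_term (n a : nat) : K :=
  (-1) ^+ a * X ^+ a * q ^+ (a * (a - 1)) * qbinom (n - a) a.

Lemma det_term0 n : det_term n 0 = 1.
Proof. by rewrite /det_term qbinom0 !expr0 !mulr1. Qed.

Lemma det_term_small n a : (n < a.*2)%N -> det_term n a = 0.
Proof. by move=> lt_na; rewrite /det_term qbinom_small ?mulr0 //; lia. Qed.

(** The q-Pascal rule with $m=n-a$; the powers of $q$ match because $a(a+1)+(n-2a) = n+a(a-1)$. *)
Lemma det_termS n a : (a <= n)%N ->
  det_term n.+2 a.+1 = det_term n.+1 a.+1 - X * q ^+ n * det_term n a.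
Proof.
move=> le_an; rewrite /det_term subSS subSn // subSS qbinomS.
(* If $n-a<a$, the subtraction in the exponent [n - a - a] truncates, but the binomials vanish. *)
have [le_a|lt_a] := leqP a (n - a); last first.
  by rewrite !(@qbinom_small (n - a)) ?mulr0 ?addr0 ?mulr0 ?subr0 // ltnW.
rewrite mulrDr; congr (_ + _).
have e : q ^+ (a.+1 * (a.+1 - 1)) * q ^+ (n - a - a) = q ^+ n * q ^+ (a * (a - 1)).
  by rewrite -!exprD; congr (_ ^+ _); case: a le_an le_a => [|a] *; nia.
by rewrite mulrA -(mulrA _ (q ^+ _) (q ^+ _)) e !exprS; ring.
Qed.

(** Letting $a$ run up to $n$ instead of $\lfloor n/2\rfloor$ adds only zero terms and avoids a case
    split on parity. The terms at $a=0$ agree; the others pair up after a shift by one. *)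
Lemma sum_det_term_rec n :
  \sum_(a < n.+3) det_term n.+2 a =
  \sum_(a < n.+2) det_term n.+1 a - X * q ^+ n * \sum_(a < n.+1) det_term n a.
Proof.
rewrite big_ord_recr /= (@det_term_small n.+2 n.+2) ?addr0; last by lia.
rewrite [LHS]big_ord_recl [X in _ = X - _]big_ord_recl /= !det_term0 -addrA; congr (_ + _).
rewrite mulr_sumr -sumrB; apply: eq_bigr => a _.
by rewrite det_termS // -ltnS.
Qed.

End QFalling.

Section DetM.

Variables (K : fieldType) (sX sq : K).

Lemma M_entry_diag (i : nat) : M_entry sX sq i.+1%:Z i.+1%:Z = 1.
Proof. by rewrite /M_entry subrr eqxx. Qed.

(** The integer exponent becomes the natural number [i], the smaller 0-based index. The same holds
    below the diagonal, so the matrix is symmetric. *)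
Lemma M_entry_super (i : nat) : M_entry sX sq i.+1%:Z i.+2%:Z = sX * sq ^+ i.
Proof.
rewrite /M_entry; have -> : i.+1%:Z - i.+2%:Z = -1 by lia.
by have -> : i.+1%:Z - 1 = i by lia.
Qed.

Lemma M_entry_sub (i : nat) : M_entry sX sq i.+2%:Z i.+1%:Z = sX * sq ^+ i.
Proof.
rewrite /M_entry; have -> : i.+2%:Z - i.+1%:Z = 1 by lia.
by have -> : i.+2%:Z - 2 = i by lia.
Qed.

Lemma M_entry_far (i j : nat) : (i.+1 < j)%N || (j.+1 < i)%N ->
  M_entry sX sq i.+1%:Z j.+1%:Z = 0.
Proof. by move=> far; rewrite /M_entry !ifF //; lia. Qed.

(** Off-diagonal entries enter only through products of symmetric pairs, so the square roots appear
    squared. *)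
Lemma det_M_rec n :
  \det (M sX sq n.+2) =
  \det (M sX sq n.+1) - sX ^+ 2 * (sq ^+ 2) ^+ n * \det (M sX sq n).
Proof.
rewrite /M (det_tridiagonal_rec (f := fun i j => M_entry sX sq i.+1%:Z j.+1%:Z)).
  rewrite M_entry_diag M_entry_super M_entry_sub mul1r.
  by rewrite mulrACA -!expr2 exprAC.
exact: M_entry_far.
Qed.

Lemma det_M_sum n : (forall k, 1 - (sq ^+ 2) ^+ k.+1 != 0) ->
  \det (M sX sq n) = \sum_(a < n.+1) det_term (sq ^+ 2) (sX ^+ 2) n a.
Proof.
move=> q_free.
(* The recurrence has order two, so the induction carries two consecutive values. *)
have [] : \det (M sX sq n) = \sum_(a < n.+1) det_term (sq ^+ 2) (sX ^+ 2) n a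
  /\ \det (M sX sq n.+1) =
     \sum_(a < n.+2) det_term (sq ^+ 2) (sX ^+ 2) n.+1 a; last by [].
elim: n => [|n [IH0 IH1]]; last by split; rewrite // det_M_rec sum_det_term_rec // IH0 IH1.
split; first by rewrite det_mx00 big_ord1 det_term0.
rewrite det_mx11 mxE M_entry_diag !big_ord_recl big_ord0 det_term0.
by rewrite det_term_small // !addr0.
Qed.

End DetM.

(** [iota] and [tofrac] are injective, which reduces the claim to $q^{k+1} \ne 1$ in $R[q]$, clear
    by degree. *)
Lemma indetq_not_root_of_unity (R : idomainType) (K : fieldType)
    (iota : {rmorphism ratfun R -> K}) (k : nat) :
  1 - iota (indetq R) ^+ k.+1 != 0.
Proof.
rewrite -rmorphXn -(rmorph1 iota) -rmorphB fmorph_eq0 /indetq.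
rewrite -rmorphXn -(rmorph1 (@tofrac {poly {poly R}})) -rmorphB tofrac_eq0.
rewrite -rmorphXn -polyC1 -polyCB polyC_eq0 subr_eq0.
apply/eqP => /(congr1 (fun p : {poly R} => size p)).
by rewrite size_polyXn size_poly1.
Qed.

Theorem theorem2 (R : idomainType) (K : fieldType)
    (iota : {rmorphism ratfun R -> K})
    (X q sX sq : K)
    (hX : X = iota (indetX R)) (hq : q = iota (indetq R))
    (hsX : sX ^+ 2 = X) (hsq : sq ^+ 2 = q)
    (n : nat) (hn : (1 <= n)%N) :
  \det (M sX sq n) =
  \sum_(0 <= a < (n %/ 2).+1)
    ((-1) ^+ a * X ^+ a * q ^+ (a * (a - 1))
       * \prod_(n - 2 * a + 1 <= m < (n - a).+1) (1 - q ^+ m))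
    / \prod_(1 <= k < a.+1) (1 - q ^+ k).
Proof.
have q_free k : 1 - q ^+ k.+1 != 0 by rewrite hq indetq_not_root_of_unity.
rewrite det_M_sum hsq ?hsX //.
rewrite -(big_mkord xpredT (det_term q X n)).
(* The sum up to $n$ is cut at $\lfloor n/2\rfloor$; beyond it $2a>n$ and the terms vanish. *)
rewrite (@big_cat_nat _ _ _ (n %/ 2).+1) //=; last by lia.
rewrite [X in _ + X]big_nat_cond [X in _ + X]big1 ?addr0; last first.
  by move=> a /andP[/andP[lt_a _] _]; rewrite det_term_small //; lia.
apply: eq_big_nat => a /andP[_ lt_a].
rewrite /det_term /qbinom mulrA; congr (_ * _ / _).
  rewrite -prod_nat_qfalling; last by lia.
  by have -> : (n - a - a = n - 2 * a)%N by lia.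
by rewrite -prod_nat_qfalling // subnn.
Qed.
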